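(* Let $\alpha<-2$ and $\beta>2$ be real numbers and let $\lambda(\alpha,\beta)$ be the Lyapunov exponent of the random product $M_N$ of the two shear matrices $A,B$ (as defined in the context). Put $$\Gamma=-\frac{\beta}{2}+\sqrt{\left(\frac{\beta}{2}\right)^2+\frac{\beta}{\alpha}}$$ and, for integers $a,b\ge1$, $$\tilde\phi_1(a,b,\alpha,\beta)=\tfrac{1}{1-\Gamma}\left(b\beta+\Gamma-a\alpha b\beta-1-a\alpha\Gamma\right),$$ $$\tilde\phi_2(a,b,\alpha,\beta)=\left(\tfrac{1}{1+\Gamma^2}\left((\Gamma+b\beta)^2+(1+a\alpha\Gamma+a\alpha b\beta)^2\right)\right)^{1/2},$$ $$\tilde\phi_\infty(a,b,\alpha,\beta)=-a\alpha b\beta-a\alpha\Gamma-1,$$ $$\tilde\psi_1(a,b,\alpha,\beta)=b\beta-a\alpha b\beta-1,$$ $$\tilde\psi_2(a,b,\alpha,\beta)=\left((-a\alpha b\beta-1)^2+b^2\beta^2\right)^{1/2},$$ $$\tilde\psi_\infty(a,b,\alpha,\beta)=-a\alpha b\beta-1.$$ For $k\in\{1,2,\infty\}$ let $$\tilde{\mathcal{L}}_k(\alpha,\beta)=\sum_{a,b=1}^\infty2^{-a-b}\log\tilde\phi_k(a,b,\alpha,\beta),\qquad\tilde{\mathcal{U}}_k(\alpha,\beta)=\sum_{a,b=1}^\infty2^{-a-b}\log\tilde\psi_k(a,b,\alpha,\beta).$$ Then $$\max_{k\in\{1,2,\infty\}}\tilde{\mathcal{L}}_k(\alpha,\beta)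\le4\lambda(\alpha,\beta)\le\min_{k\in\{1,2,\infty\}}\tilde{\mathcal{U}}_k(\alpha,\beta).$$
   Context: For real $\alpha,\beta$ let $A=\begin{pmatrix}1&0\\ \alpha&1\end{pmatrix}$ and $B=\begin{pmatrix}1&\beta\\0&1\end{pmatrix}$. Let $M_N=\prod_{k=1}^N A_{i_k}$ be the random product in which the $N$ factors are i.i.d., each equal to $A_1=A$ or $A_2=B$ with probability $1/2$. The Lyapunov exponent is $\lambda(\alpha,\beta)=\lim_{N\to\infty}\frac1N\,\mathbb{E}\log\|M_N\|$ (independent of the matrix norm), equivalently $\lim_{N\to\infty}\frac1N\,\mathbb{E}\log\|M_NX_0\|$ for an arbitrary nonzero vector $X_0\in\mathbb{R}^2$ and any vector norm. The logarithm is natural. *)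

(* Defs.v *)
(* MathComp-Analysis *)
From HB Require Import structures.
From mathcomp Require Import all_boot all_order all_algebra finmap.
From mathcomp Require Import all_classical all_reals all_analysis.

Set Implicit Arguments.
Unset Strict Implicit.
Unset Printing Implicit Defensive.

Import Order.TTheory GRing.Theory Num.Theory.
Import numFieldNormedType.Exports.

Local Open Scope classical_set_scope.
Local Open Scope ring_scope.

Definition shearA (R : realType) (alpha : R) : 'M[R]_2 :=
  1 + alpha *: delta_mx 1 0.

Definition shearB (R : realType) (beta : R) : 'M[R]_2 :=
  1 + beta *: delta_mx 0 1.

(* The index i_k is encoded as a boolean, true standing for A and false for B;
   the factors are numbered from 0 and multiplied from left to right. *)
Definition shear_product (R : realType) (alpha beta : R) (i : nat -> bool)
    (N : nat) : 'M[R]_2 :=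
  \prod_(k < N) (if i k then shearA alpha else shearB beta).

Definition mutually_independent d d' (T : measurableType d)
    (T' : measurableType d') (R : realType) (P : probability T R)
    (X : nat -> {RV P >-> T'}) : Prop :=
  forall (J : {fset nat}) (E : nat -> set T'),
    (forall k, measurable (E k)) ->
    P (\bigcap_(k in [set` J]) (X k @^-1` E k))
      = (\prod_(k <- J) P (X k @^-1` E k))%E.

Definition iid_fair_coins d (T : measurableType d) (R : realType)
    (P : probability T R) (X : nat -> {RV P >-> bool}) : Prop :=
  mutually_independent X /\
  forall (k : nat) (c : bool), P (X k @^-1` [set c]) = (2^-1)%:E.

(* `|M| is the library norm on matrices (largest absolute value of an entry);
   the limit does not depend on the choice of norm. *)
Definition lyapunov_exponent d (T : measurableType d) (R : realType)
    (P : probability T R) (X : nat -> {RV P >-> bool}) (alpha beta : R)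
    : \bar R :=
  limn (fun N : nat =>
    ((N%:R^-1)%:E *
     'E_P[fun w => ln `|shear_product alpha beta (fun k => X k w) N|])%E).

Section bounds.
Variable R : realType.
Implicit Types (alpha beta : R) (a b : nat).

Definition Gam alpha beta : R :=
  - (beta / 2) + Num.sqrt ((beta / 2) ^+ 2 + beta / alpha).

Definition phi1 alpha beta a b : R :=
  let G := Gam alpha beta in
  (1 - G)^-1 * (b%:R * beta + G - a%:R * alpha * b%:R * beta - 1
                - a%:R * alpha * G).

Definition phi2 alpha beta a b : R :=
  let G := Gam alpha beta in
  Num.sqrt ((1 + G ^+ 2)^-1 *
    ((G + b%:R * beta) ^+ 2
     + (1 + a%:R * alpha * G + a%:R * alpha * b%:R * beta) ^+ 2)).

Definition phioo alpha beta a b : R :=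
  let G := Gam alpha beta in
  - (a%:R * alpha * b%:R * beta) - a%:R * alpha * G - 1.

Definition psi1 alpha beta a b : R :=
  b%:R * beta - a%:R * alpha * b%:R * beta - 1.

Definition psi2 alpha beta a b : R :=
  Num.sqrt ((- (a%:R * alpha * b%:R * beta) - 1) ^+ 2
            + b%:R ^+ 2 * beta ^+ 2).

Definition psioo alpha beta a b : R :=
  - (a%:R * alpha * b%:R * beta) - 1.

Definition log_sum (f : nat -> nat -> R) : \bar R :=
  (\sum_(1 <= a <oo) \sum_(1 <= b <oo) (2 ^- (a + b) * ln (f a b))%:E)%E.

End bounds.

(* Main.v *)
(* Each block [A^a B^b] with [a, b >= 1] maps the cone of directions [(r, 1)],
   [Gamma <= r <= 0], into itself ([Gamma] is the fixed direction of [A B]), and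
   on this cone it multiplies the k-norm by a factor between [phi_k a b] and
   [psi_k a b], the values at the two ends of the cone.  So, up to an additive
   constant and an incomplete block, the logarithm of the norm of a word is
   bounded by the sum of [ln phi_k] and [ln psi_k] over its blocks.  In a random
   word a block with lengths [a, b] is completed at a given position with
   probability [2^-(a + b + 2)] away from the ends, hence the expected block sum
   of a word of length [N] grows like [N / 4] times the double series. *)
Require Import Defs.
From mathcomp Require Import all_boot all_order all_algebra finmap.
From mathcomp Require Import all_classical all_reals all_analysis.
From mathcomp Require Import ring lra.

Set Implicit Arguments.
Unset Strict Implicit.
Unset Printing Implicit Defensive.

Import Order.TTheory GRing.Theory Num.Theory.
Import numFieldNormedType.Exports.

Local Open Scope ring_scope.

(** * Averages over words *)

Section WordAverage.
Context {R : realFieldType}.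
Implicit Types (F G : seq bool -> R) (N M : nat).

(** The expectation of [F] over [N] fair letters, in recursive form so that conditioning on the
    leftmost letter is mere computation; [wavgE] relates it to the sum over all words. *)
Fixpoint wavg N F : R :=
  if N is N'.+1 then
    (wavg N' (fun w => F (true :: w)) + wavg N' (fun w => F (false :: w))) / 2
  else F [::].

Lemma wavgD N F G : wavg N (fun w => F w + G w) = wavg N F + wavg N G.
Proof.
elim: N F G => [//|N IH] F G /=.
by rewrite (IH (fun w => F (true :: w))) (IH (fun w => F (false :: w))); field.
Qed.

Lemma wavg_cst N (c : R) : wavg N (fun=> c) = c.
Proof. by elim: N => [//|N /= ->]; field. Qed.

Lemma le_wavg N F G : (forall w, F w <= G w) -> wavg N F <= wavg N G.
Proof.
elim: N F G => [|N IH] F G FG /=; first exact: FG.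
by rewrite ler_pM2r ?invr_gt0// lerD// IH.
Qed.

Lemma wavg_cat N M F :
  wavg (N + M) F = wavg N (fun w => wavg M (fun w' => F (w ++ w'))).
Proof. by elim: N F => [//|N IH] F /=; rewrite !IH. Qed.

End WordAverage.

(** * Expected block sums of random words *)

Section Runs.
Context {R : realType} (g : nat -> nat -> R).
Hypothesis g_ge0 : forall a b, 0 <= g a b.

(* Value [g a' b'] of the leftmost block of [w] when a run of [a] letters [A],
   respectively a run [A^a B^b], has already been read on its left.  At the end
   of the word a missing run of [B]'s counts as one [B]. *)
Fixpoint runB (a b : nat) (w : seq bool) : R :=
  match w with
  | [::] => g a b
  | true :: _ => g a b
  | false :: w' => runB a b.+1 w'
  end.

Fixpoint runA (a : nat) (w : seq bool) : R :=
  match w with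
  | [::] => g a 1
  | true :: w' => runA a.+1 w'
  | false :: w' => runB a 1 w'
  end.

Definition head_block (w : seq bool) : R :=
  if w is true :: w' then runA 1 w' else 0.

(* Only blocks that are followed by a [B] on their left are counted, so that
   each block is counted once, at full length. *)
Fixpoint block_total (w : seq bool) : R :=
  match w with
  | [::] => 0
  | true :: w' => block_total w'
  | false :: w' => block_total w' + head_block w'
  end.

Lemma runB_ge0 a b w : 0 <= runB a b w.
Proof. by elim: w a b => [|[] w IH] a b /=. Qed.

Lemma runA_ge0 a w : 0 <= runA a w.
Proof. by elim: w a => [|[] w IH] a //=; exact: runB_ge0. Qed.

Lemma head_block_ge0 w : 0 <= head_block w.
Proof. by case: w => [|[] w] //=; exact: runA_ge0. Qed.

Lemma block_total_ge0 w : 0 <= block_total w.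
Proof. by elim: w => [|[] w IH] //=; rewrite addr_ge0// head_block_ge0. Qed.

Lemma wavg_ge0 N (F : seq bool -> R) : (forall w, 0 <= F w) -> 0 <= wavg N F.
Proof. by move=> F0; rewrite -(wavg_cst N 0) le_wavg. Qed.

Lemma wavg_head_block m : wavg m.+1 head_block = wavg m (runA 1) / 2.
Proof. by rewrite /= wavg_cst addr0. Qed.

(** A new letter on the left contributes only if it is [B], and [head_block] is nonzero only if the
    next one is [A]. These two factors [1/2] make the increment a quarter of the mean of [runA 1],
    the source of the 4 in the theorem. *)
Lemma wavg_block_total m :
  wavg m.+1 block_total = wavg m block_total + wavg m head_block / 2.
Proof. by rewrite /= wavgD; field. Qed.

(** Each further letter ends the run of [B]'s with probability [1/2], so unrolling the recursion
    produces the weights [2 ^- (a + j)]. A word of length [m >= n] is long enough for the first [n]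
    of these terms; the rest is dropped by nonnegativity. *)
Lemma wavg_runB_ge n m a b : (n <= m)%N ->
  \sum_(b <= j < b + n) 2 ^- (a + j) * g a j
    <= 2 * (2 ^- (a + b) * wavg m (runB a b)).
Proof.
elim: n m b => [|n IH] m b nm.
  rewrite addn0 big_geq// !mulr_ge0// ?invr_ge0 ?exprn_ge0//.
  exact/wavg_ge0/runB_ge0.
case: m nm => // m nm; rewrite big_ltn ?addnS ?ltnS ?leq_addr// -addSn.
apply: (le_trans (lerD (lexx _) (IH m b.+1 nm))).
rewrite /= wavg_cst addnS exprS invfM le_eqVlt; apply/orP; left; apply/eqP.
by field; rewrite expf_neq0.
Qed.

(** Same unrolling over the run of [A]'s: up to [q] letters are spent on it, which leaves at least
    [n] for the run of [B]'s. *)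
Lemma wavg_runA_ge q n m a : (q + n <= m)%N ->
  \sum_(a <= i < a + q) \sum_(1 <= j < 1 + n) 2 ^- (i + j) * g i j
    <= 2 * (2 ^- a * wavg m (runA a)).
Proof.
elim: q m a => [|q IH] m a nm.
  rewrite addn0 big_geq// !mulr_ge0// ?invr_ge0 ?exprn_ge0//.
  exact/wavg_ge0/runA_ge0.
case: m nm => // m nm; rewrite big_ltn ?addnS ?ltnS ?leq_addr// -addSn.
have nm' : (n <= m)%N := leq_trans (leq_addl q n) nm.
apply: (le_trans (lerD (@wavg_runB_ge n m a 1 nm') (IH m a.+1 nm))).
rewrite /= addn1 exprS invfM le_eqVlt; apply/orP; left; apply/eqP.
by field; rewrite expf_neq0.
Qed.

Lemma wavg_block_total_ge n m :
  (m%:R - (n + n).+1%:R)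
    * (\sum_(1 <= i < 1 + n) \sum_(1 <= j < 1 + n) 2 ^- (i + j) * g i j) / 4
  <= wavg m block_total.
Proof.
set S := \sum_(1 <= i < _) _.
have S0 : 0 <= S.
  by apply: sumr_ge0 => i _; apply: sumr_ge0 => j _;
    rewrite mulr_ge0// invr_ge0 exprn_ge0.
have G0 k : 0 <= wavg k block_total by exact/wavg_ge0/block_total_ge0.
elim: m => [|m IH].
  apply: le_trans (G0 0%N); rewrite -[leRHS](mul0r 4^-1) ler_pM2r// -oppr_ge0.
  by rewrite sub0r mulNr opprK mulr_ge0.
(* Up to length [2n + 1] the left-hand side is nonpositive; beyond it every new letter adds at least
   [S / 4]. *)
have [mn|mn] := leqP m.+1 (n + n).+1.
  apply: le_trans (G0 m.+1); rewrite -[leRHS](mul0r 4^-1) ler_pM2r//.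
  by rewrite mulr_le0_ge0// subr_le0 ler_nat.
case: m mn IH => // m; rewrite !ltnS => mn IH.
rewrite wavg_block_total wavg_head_block.
have := @wavg_runA_ge n n m 1 mn; rewrite -/S expr1 mulrA divff// mul1r => SA.
rewrite -[in leLHS]addn1 natrD.
move: IH SA; set x := wavg _ _; set y := wavg _ _; set u := _%:R; set v := _%:R.
by move=> IH SA; lra.
Qed.

Section UpperBound.
Hypothesis gS1 : forall a b, g a b <= g a.+1 b.
Hypothesis gS2 : forall a b, g a b <= g a b.+1.

Let g_homo1 b : {homo g^~ b : a a' / (a <= a')%N >-> a <= a'}.
Proof. by apply: homo_leq => //; exact: le_trans. Qed.

Let g_homo2 a : {homo g a : b b' / (b <= b')%N >-> b <= b'}.
Proof. by apply: homo_leq => //; exact: le_trans. Qed.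

(** The weights [2 ^- j] from [b] on add up to [2 * 2 ^- b]. Since the series may be infinite, its
    value is compared with the closed form of finite geometric sums, whose limit is then taken. *)
Lemma geometric_tail_ge (u : nat -> \bar R) (c : R) b : 0 <= c ->
  (forall j, (b <= j)%N -> (c%:E <= u j)%E) ->
  ((2 * (2 ^- b * c))%:E <= \sum_(b <= j <oo) (2 ^- j)%:E * u j)%E.
Proof.
move=> c0 cu.
have pos j : (0 <= 2 ^- j :> R) by rewrite invr_ge0 exprn_ge0.
have partial n : ((2 * c * (2 ^- b - 2 ^- (b + n)))%:E
    <= \sum_(b <= j <oo) (2 ^- j)%:E * u j)%E.
  apply: le_trans (nneseries_lim_ge (b + n) _); last first.
    move=> j bj _; apply: mule_ge0; first by rewrite lee_fin.
    by apply: le_trans (cu j bj); rewrite lee_fin.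
  elim: n => [|n IH]; first by rewrite addn0 subrr mulr0 big_geq.
  rewrite addnS big_nat_recr/= ?leq_addr//.
  apply: le_trans (leeD IH (lee_wpmul2l _ (cu _ _))); last 2 first.
  - by rewrite lee_fin.
  - by rewrite leq_addr.
  rewrite -EFinM -EFinD lee_fin exprS invfM le_eqVlt; apply/orP; left; apply/eqP.
  by field; rewrite !expf_neq0.
have : ((fun n => (2 * c * (2 ^- b - 2 ^- (b + n)))%:E) @ \oo
    --> (2 * (2 ^- b * c))%:E)%classic.
  apply: cvg_EFin; first by near=> n.
  rewrite /comp /=.
  have -> : 2 * (2 ^- b * c) = 2 * c * (2 ^- b - 0) by ring.
  apply: cvgMr; apply: cvgB; first exact: cvg_cst.
  have /cvg_geometric : `|2^-1 : R| < 1.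
    by rewrite ger0_norm ?invr_ge0// invf_lt1// ltr1n.
  move=> /(_ (2 ^- b)); apply: cvg_trans; apply: near_eq_cvg; near=> n.
  by rewrite /= exprD invfM exprVn.
move=> cv; rewrite -(cvg_lim _ cv)//.
apply: lime_le; first by apply/cvg_ex; eexists; exact: cv.
by near=> n; exact: partial.
Unshelve. all: by end_near.
Qed.

Let nnE a j : (0 <= (2 ^- (a + j) * g a j)%:E)%E.
Proof. by rewrite lee_fin mulr_ge0// invr_ge0 exprn_ge0. Qed.

(* Monotonicity of [g] makes the right-hand side, the conditional expectation
   for infinite words, dominate also the words that end inside the run. *)
Lemma wavg_runB_le m a b :
  ((2 * (2 ^- (a + b) * wavg m (runB a b)))%:E
    <= \sum_(b <= j <oo) (2 ^- (a + j) * g a j)%:E)%E.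
Proof.
have tailS b' : (\sum_(b' <= j <oo) (2 ^- (a + j) * g a j)%:E
    = (2 ^- (a + b') * g a b')%:E
      + \sum_(b'.+1 <= j <oo) (2 ^- (a + j) * g a j)%:E)%E.
  by rewrite (nneseries_split b' 1) ?addn1 ?big_nat1.
elim: m b => [|m IH] b /=; last first.
  rewrite tailS wavg_cst; apply: le_trans (leeD (lexx _) (IH b.+1)).
  rewrite -EFinD lee_fin addnS exprS invfM le_eqVlt; apply/orP; left; apply/eqP.
  by field; rewrite !expf_neq0.
rewrite exprD invfM -mulrA.
have : forall j, (b <= j)%N -> ((2 ^- a * g a b)%:E <= (2 ^- a * g a j)%:E)%E.
  move=> j bj; rewrite lee_fin ler_pM2l ?invr_gt0 ?exprn_gt0//.
  exact: g_homo2.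
have c0 : 0 <= 2 ^- a * g a b by rewrite mulr_ge0// invr_ge0 exprn_ge0.
move=> /(@geometric_tail_ge (fun j => (2 ^- a * g a j)%:E) _ _ c0).
rewrite [2 ^- b * (_ * _)]mulrCA => /le_trans; apply.
rewrite le_eqVlt; apply/orP; left; apply/eqP; apply: eq_eseriesr => j _.
by rewrite -EFinM exprD invfM mulrA [2 ^- j * _]mulrC.
Qed.

Lemma wavg_runA_le m a :
  ((2 * (2 ^- a * wavg m (runA a)))%:E <=
    \sum_(a <= i <oo) \sum_(1 <= j <oo) (2 ^- (i + j) * g i j)%:E)%E.
Proof.
have rowE i : (\sum_(1 <= j <oo) (2 ^- (i + j) * g i j)%:E
    = (2 ^- i)%:E * \sum_(1 <= j <oo) (2 ^- j * g i j)%:E)%E.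
  rewrite -nneseriesZl.
    by apply: eq_eseriesr => j _; rewrite -EFinM exprD invfM mulrA.
  by move=> j _; rewrite lee_fin mulr_ge0// invr_ge0 exprn_ge0.
have row_ge0 i : (0 <= \sum_(1 <= j <oo) (2 ^- (i + j) * g i j)%:E)%E.
  exact: nneseries_ge0.
elim: m a => [|m IH] a /=; last first.
  rewrite (nneseries_split a 1) ?addn1 ?big_nat1//.
  apply: le_trans (leeD (wavg_runB_le m a 1) (IH a.+1)).
  rewrite -EFinD lee_fin addn1 exprS invfM le_eqVlt; apply/orP; left; apply/eqP.
  by field; rewrite !expf_neq0.
(* At the end of the word the value is [g a 1], which by monotonicity is below every [g i j] with
   [i >= a] and [j >= 1]; the weights of these terms add up to [2 * 2 ^- a]. *)
under eq_eseriesr do rewrite rowE.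
apply: (@geometric_tail_ge
  (fun i => \sum_(1 <= j <oo) (2 ^- j * g i j)%:E)%E) => // i ai.
have -> : g a 1 = 2 * (2 ^- 1 * g a 1) by rewrite expr1 mulrA divff// mul1r.
under eq_eseriesr do rewrite EFinM.
apply: (@geometric_tail_ge (fun j => (g i j)%:E)) => // j j1; rewrite lee_fin.
exact: le_trans (g_homo1 1 ai) (g_homo2 i j1).
Qed.

Lemma wavg_block_total_le (L : R) m :
  (\sum_(1 <= i <oo) \sum_(1 <= j <oo) (2 ^- (i + j) * g i j)%:E <= L%:E)%E ->
  wavg m (runA 1) <= L /\ wavg m block_total <= m%:R * L / 4.
Proof.
move=> SL; have runL k : wavg k (runA 1) <= L.
  rewrite -lee_fin (le_trans _ SL)//; apply: le_trans (wavg_runA_le k 1).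
  by rewrite expr1 mulrA divff// mul1r.
have headL k : wavg k head_block <= L / 2.
  case: k => [|k]; last by rewrite wavg_head_block ler_pM2r// runL.
  by rewrite divr_ge0// (le_trans _ (runL 0%N)) /=.
split=> //; elim: m => [|m IH]; first by rewrite !mul0r.
rewrite wavg_block_total -[in leRHS]addn1 natrD.
by move: IH (headL m) => IH hm; lra.
Qed.

End UpperBound.
End Runs.

(** * Dynamics on the cone *)

Section Cone.
Context {R : realType} (alpha beta : R).
Hypotheses (Halpha : alpha < -2) (Hbeta : 2 < beta).
Local Notation Gamma := (Gam alpha beta).

Let alpha_neq0 : alpha != 0.
Proof. by apply/eqP => a0; move: Halpha; rewrite a0; lra. Qed.

(** From [alpha^-1 > - 1/2] and [beta > 2] one gets [beta * (1 + alpha^-1) > 1]. The inequality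
    makes the root in [Gamma] real and gives [Gamma > -1]. *)
Let discr_gt : (beta / 2 - 1) ^+ 2 < (beta / 2) ^+ 2 + beta / alpha.
Proof.
have [Ha Hb] := (Halpha, Hbeta).
have ai0 : 0 < - alpha^-1 by rewrite oppr_gt0 invr_lt0; lra.
have : 0 < (-2 - alpha) * - alpha^-1 by rewrite mulr_gt0//; lra.
rewrite mulrN mulrBl mulfV// => ai.
have : 0 < beta * (alpha^-1 + 2^-1) by rewrite mulr_gt0//; lra.
by lra.
Qed.

Let discr_ge0 : 0 <= (beta / 2) ^+ 2 + beta / alpha.
Proof. exact: le_trans (sqr_ge0 _) (ltW discr_gt). Qed.

(** This is the fixed-direction equation of [A B]: [(Gamma, 1)] is sent to
    [(Gamma + beta, 1 + alpha (Gamma + beta))], which has to be proportional to [(Gamma, 1)]. *)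
Lemma Gam_root : alpha * Gamma * (Gamma + beta) = beta.
Proof.
rewrite /Gam; have := sqr_sqrtr discr_ge0.
set q := Num.sqrt _ => qD.
have -> : alpha * (- (beta / 2) + q) * (- (beta / 2) + q + beta)
   = alpha * (q ^+ 2 - (beta / 2) ^+ 2) by field.
by rewrite qD; field.
Qed.

Lemma Gam_lt0 : Gamma < 0.
Proof.
have [Ha Hb] := (Halpha, Hbeta).
rewrite /Gam addrC subr_lt0 -[ltRHS]ger0_norm; last by lra.
rewrite -sqrtr_sqr ltr_sqrt ?exprn_gt0//; last by lra.
by rewrite gtrDl pmulr_rlt0 ?invr_lt0; lra.
Qed.

Lemma Gam_gtN1 : -1 < Gamma.
Proof.
have [Ha Hb] := (Halpha, Hbeta).
have : beta / 2 - 1 < Num.sqrt ((beta / 2) ^+ 2 + beta / alpha).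
  rewrite -[ltLHS]ger0_norm; last by lra.
  by rewrite -sqrtr_sqr ltr_sqrt ?(le_lt_trans _ discr_gt)// sqr_ge0.
by rewrite /Gam; lra.
Qed.

(* [shift b r] and [scale a t] give the image of the direction [(r, 1)] under
   [A^a B^b]: with [t := shift b r] it is [(t, scale a t)]. *)
Definition shift (b : nat) (r : R) : R := r + b%:R * beta.
Definition scale (a : nat) (t : R) : R := 1 + a%:R * alpha * t.

Lemma shift_gt1 b r : (0 < b)%N -> Gamma <= r -> 1 < shift b r.
Proof.
have [Ha Hb] := (Halpha, Hbeta).
move=> b0 Gr; have b1 : 1 <= b%:R :> R by rewrite ler1n.
have := Gam_gtN1; rewrite /shift => G1.
have : 0 <= (b%:R - 1) * beta by rewrite mulr_ge0//; lra.
by lra.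
Qed.

Lemma scale_ltN1 a t : (0 < a)%N -> 1 < t -> scale a t < -1.
Proof.
have [Ha Hb] := (Halpha, Hbeta).
move=> a0 t1; have a1 : 1 <= a%:R :> R by rewrite ler1n.
rewrite /scale -mulrA; have at0 : alpha * t < -2.
  have : 0 < (-2 - alpha) * t by rewrite mulr_gt0//; lra.
  by lra.
have : 0 <= (a%:R - 1) * (- (alpha * t)) by rewrite mulr_ge0//; lra.
by lra.
Qed.

(** The quotient is negative because [t > 1] and [s < -1]. The lower bound amounts to
    [t <= Gamma + a k t] with [k = alpha * Gamma]. By [Gam_root] this is an equality for [a = 1] and
    [t = Gamma + beta], and since [k > 1] it persists for larger [a] and [t]. *)
Lemma cone_step a b r : (0 < a)%N -> (0 < b)%N -> Gamma <= r ->
  Gamma <= shift b r / scale a (shift b r) <= 0.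
Proof.
have [Ha Hb] := (Halpha, Hbeta).
move=> a0 b0 Gr; have t1 := shift_gt1 b0 Gr.
have s1 := scale_ltN1 a0 t1.
have tGb : Gamma + beta <= shift b r.
  have b1 : 1 <= b%:R :> R by rewrite ler1n.
  have : 0 <= (b%:R - 1) * beta by rewrite mulr_ge0//; lra.
  by rewrite /shift; lra.
move: t1 s1 tGb; set t := shift b r; set s := scale a t => t1 s1 tGb.
apply/andP; split; last by rewrite pmulr_rle0 ?invr_le0; lra.
rewrite ler_ndivlMr; last by lra.
have G0 := Gam_lt0; have G1 := Gam_gtN1; have GR := Gam_root.
set k := alpha * Gamma in GR.
have k1 : 1 < k.
  have Gb : 0 < Gamma + beta by lra.
  by rewrite -(ltr_pM2r Gb) mul1r GR; lra.
have a1 : 1 <= a%:R :> R by rewrite ler1n.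
have -> : Gamma * s = Gamma + a%:R * k * t by rewrite /s /scale /k; ring.
clearbody t k.
have e1 : 0 <= (a%:R - 1) * (k * t).
  by rewrite mulr_ge0 ?subr_ge0// mulr_ge0//; lra.
have e2 : 0 <= (k - 1) * (t - (Gamma + beta)) by rewrite mulr_ge0//; lra.
by lra.
Qed.

Fixpoint act (w : seq bool) (x : R * R) : R * R :=
  match w with
  | [::] => x
  | true :: w' => let y := act w' x in (y.1, alpha * y.1 + y.2)
  | false :: w' => let y := act w' x in (y.1 + beta * y.2, y.2)
  end.

Definition wmx (w : seq bool) : 'M[R]_2 :=
  \prod_(c <- w) (if c then shearA alpha else shearB beta).

Lemma wmx_act w x :
  wmx w 0 0 * x.1 + wmx w 0 1 * x.2 = (act w x).1 /\
  wmx w 1 0 * x.1 + wmx w 1 1 * x.2 = (act w x).2.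
Proof.
have E (c : bool) (M : 'M[R]_2) i j :
  ((if c then shearA alpha else shearB beta) * M) i j
  = M i j + (if c then (i == 1)%:R * alpha * M 0 j
             else (i == 0)%:R * beta * M 1 j).
  rewrite -[_ * M]/(_ *m M) mxE big_ord_recl big_ord1.
  have -> : lift ord0 ord0 = 1 :> 'I_2 by exact/val_inj.
  have -> : ord0 = 0 :> 'I_2 by exact/val_inj.
  have iP : i = 0 \/ i = 1.
    by case: i => [[|[|//]] p]; [left|right]; exact/val_inj.
  by case: iP => ->; case: c; rewrite !mxE /= ?mulr0n ?mulr1n; ring.
rewrite /wmx; elim: w => [|c w [IH1 IH2]].
  by rewrite big_nil !mxE /= !mulr0n !mulr1n; split; ring.
rewrite big_cons !E; case: c => /=; rewrite -IH1 -IH2; split; ring.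
Qed.

(** * Norm growth along a word *)

Section Growth.
Variables (phi psi : nat -> nat -> R) (n : R -> R).
Hypothesis phi_ge1 : forall a b, (0 < a)%N -> (0 < b)%N -> 1 <= phi a b.
Hypothesis psi_ge1 : forall a b, (0 < a)%N -> (0 < b)%N -> 1 <= psi a b.
Hypothesis n_bounds : forall r, Gamma <= r <= 0 -> 1 <= n r <= 2.
Hypothesis growth : forall a b r, (0 < a)%N -> (0 < b)%N -> Gamma <= r <= 0 ->
  let t := shift b r in
  phi a b * n r <= `|scale a t| * n (t / scale a t) <= psi a b * n r.

(** The value 0 on empty runs keeps the function nonnegative, and monotone when [f] is, at all
    indices, although [f] is controlled only for [a, b >= 1]. *)
Definition log_block (f : nat -> nat -> R) (a b : nat) : R :=
  if (0 < a)%N && (0 < b)%N then ln (f a b) else 0.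

Lemma expR_log_block (f : nat -> nat -> R) a b : (0 < a)%N -> (0 < b)%N ->
  1 <= f a b -> expR (log_block f a b) = f a b.
Proof.
by move=> a0 b0 f1; rewrite /log_block a0 b0 lnK// posrE (lt_le_trans ltr01).
Qed.

(* Write [w = A^a B^b w'] with maximal runs: the block on its left may be
   incomplete, and [s (r, 1)] is the image of the start vector under [w'].  A final run of [A]'s is completed to a block by starting from
   [B (r0, 1)] instead of [(r0, 1)]. *)
Lemma word_state (r0 : R) (w : seq bool) : Gamma <= r0 <= 0 ->
  let z := (if last true w then beta + r0 else r0, 1) in
  exists (s r : R) (a b : nat), let t := shift b r in
  [/\ Gamma <= r <= 0, (0 < b)%N,
      act w z = (s * t, s * scale a t),
      forall g : nat -> nat -> R,
        [/\ head_block g w = if (0 < a)%N then g a b else 0,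
            forall k, runA g k w = g (k + a)%N b &
            w != [::] -> forall k j, runB g k j w =
              if (0 < a)%N then g k j else g k (j + b)%N] &
      expR (block_total (log_block phi) w) * n r0 <= `|s| * n r
        <= expR (block_total (log_block psi) w) * n r0].
Proof.
move=> r0P; elim: w => [|c w IH] /=.
  (* For the empty word the [B] built into the start vector is the run [b = 1], in agreement with
     the value [g a 1] of [runA] at the end of a word. *)
  exists 1, r0, 0%N, 1%N; split=> //.
  - by rewrite /shift /scale !mul0r addr0 !mul1r addrC.
  - by move=> g; split=> // k; rewrite addn0.
  - by rewrite normr1 !expR0 !mul1r lexx.
(* The first letter read decides the start vector: a final [B] takes the place of the built-in one,
   so [b] remains 1. For longer words the last letter no longer changes. *)
case: (altP (w =P [::])) => [->|wn0] /=.
  case: c {IH} => /=.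
    exists 1, r0, 1%N, 1%N; split=> //.
    - by rewrite /shift /scale; congr pair; ring.
    - by move=> g; split=> // k; rewrite addn1.
    - by rewrite normr1 !expR0 !mul1r lexx.
  exists 1, r0, 0%N, 1%N; split=> //.
  - by rewrite /shift /scale; congr pair; ring.
  - by move=> g; split=> [//|k|_ k j]; rewrite ?addn0// addn1.
  - by rewrite addr0 normr1 !expR0 !mul1r lexx.
have lastE : last c w = last true w by case: (w) wn0.
rewrite lastE; case: IH => s [r] [a] [b] [rP b0 -> gP nP].
case: c {lastE}.
  exists s, r, a.+1, b; split=> //=.
  - by congr pair; rewrite /scale -natr1; ring.
  - move=> g; have [_ gA _] := gP g; split=> [|k|//]; first by rewrite gA.
    by rewrite gA addnS.
have [a0|] := ltnP 0 a; last first.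
  rewrite leqn0 => /eqP a0; rewrite a0 /= in gP *.
  exists s, r, 0%N, b.+1; split=> //=.
  - by congr pair; rewrite /scale /shift -natr1; ring.
  - move=> g; have [_ _ /(_ wn0) gB] := gP g.
    split=> [//|k|_ k j]; rewrite gB; first by rewrite addn0 add1n.
    by rewrite addSnnS.
  - have [-> _ _] := gP (log_block phi); have [-> _ _] := gP (log_block psi).
    by rewrite !addr0.
set t := shift b r; set u := scale a t.
have t1 : 1 < t by apply: shift_gt1 => //; case/andP: rP.
have u1 : u < -1 by apply: scale_ltN1.
have u0 : u != 0 by rewrite lt_eqF// (lt_trans u1)// oppr_lt0.
(* The block [A^a B^b] is now complete: it has turned the direction into [t / u] with the factor
   [u], and the new [B] opens the next block. *)
exists (s * u), (t / u), 0%N, 1%N; split=> //=.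
- by apply: cone_step => //; case/andP: rP.
- by rewrite /scale /shift; congr pair; field.
- move=> g; have [_ _ /(_ wn0) gB] := gP g.
  split=> [//|k|_ k j]; rewrite gB a0 ?addn0// addn1//.
- have [-> _ _] := gP (log_block phi); have [-> _ _] := gP (log_block psi).
  rewrite a0 !expRD !expR_log_block ?phi_ge1 ?psi_ge1// normrM.
  have /andP[lo hi] := growth a0 b0 rP.
  case/andP: nP => nlo nhi.
  have p0 : 0 <= phi a b by rewrite (le_trans ler01)// phi_ge1.
  have q0 : 0 <= psi a b by rewrite (le_trans ler01)// psi_ge1.
  apply/andP; split.
    rewrite mulrAC (le_trans (ler_wpM2r p0 nlo))//.
    by rewrite -!mulrA ler_wpM2l// [n r * _]mulrC.
  rewrite [leRHS]mulrAC (le_trans _ (ler_wpM2r q0 nhi))//.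
  by rewrite -!mulrA ler_wpM2l// [n r * _]mulrC.
Qed.

Lemma ler_mx_entry (M : 'M[R]_2) i j : `|M i j| <= `|M|.
Proof.
rewrite [leRHS]/Num.norm/= mx_normrE.
exact: (le_bigmax 0 (fun ij : 'I_2 * 'I_2 => `|M ij.1 ij.2|) (i, j)).
Qed.

Lemma mx2_norm_le (M : 'M[R]_2) (c : R) :
  `|M 0 0| <= c -> `|M 0 1| <= c -> `|M 1 0| <= c -> `|M 1 1| <= c -> `|M| <= c.
Proof.
move=> h00 h01 h10 h11; rewrite [leLHS]/Num.norm/= mx_normrE.
have iP (i : 'I_2) : i = 0 \/ i = 1.
  by case: i => [[|[|//]] p]; [left|right]; exact/val_inj.
apply: bigmax_le => [|[i j] _ /=]; first exact: le_trans (normr_ge0 _) h00.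
by case: (iP i) => ->; case: (iP j) => ->.
Qed.

Let zero_cone : Gamma <= 0 <= (0 : R).
Proof. by rewrite ltW ?Gam_lt0 /=. Qed.

(** The first coordinate [s * t] of the image has [t > 1], so it bounds [|s|]; it is itself at most
    [beta + 1] times the norm of the matrix. The factor 2 bounds [n r]. *)
Lemma wmx_norm_ge (w : seq bool) :
  expR (block_total (log_block phi) w) <= 2 * (beta + 1) * `|wmx w|.
Proof.
have [Ha Hb] := (Halpha, Hbeta).
have [s [r [a [b [rP b0 zE _ /andP[nlo _]]]]]] := word_state w zero_cone.
have [n1 _] := andP (n_bounds zero_cone); have [_ n2] := andP (n_bounds rP).
have t1 : 1 < shift b r by apply: shift_gt1 => //; case/andP: rP.
have [+ _] := wmx_act w (if last true w then beta + 0 else 0, 1).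
rewrite zE /= mulr1 => stE.
have sM : `|s| <= (beta + 1) * `|wmx w|.
  apply: (@le_trans _ _ `|s * shift b r|).
    by rewrite normrM ler_peMr// ger0_norm; lra.
  rewrite -stE (le_trans (ler_normD _ _))// mulrDl mul1r normrM.
  apply: lerD; last exact: ler_mx_entry.
  rewrite mulrC ler_pM ?ler_mx_entry//.
  by case: ifP => _; rewrite ?addr0 ?normr0 ?ger0_norm; lra.
rewrite -mulrA (le_trans _ (ler_wpM2l (ler0n _ 2) sM))//.
rewrite mulrC (le_trans _ (ler_wpM2l (normr_ge0 s) n2))//.
by apply: le_trans nlo; rewrite ler_peMr// expR_ge0.
Qed.

(** One more [A] on the left turns the possibly incomplete leading block into a full one, to which
    [growth] applies; this is the term [runA 1]. Removing that [A] again costs the factor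
    [1 - alpha]. *)
Lemma act_norm_le (w : seq bool) r0 : Gamma <= r0 <= 0 ->
  let z := act w (if last true w then beta + r0 else r0, 1) in
  let c := 2 * (1 - alpha)
    * expR (block_total (log_block psi) w + runA (log_block psi) 1 w) in
  `|z.1| <= c /\ `|z.2| <= c.
Proof.
have [Ha Hb] := (Halpha, Hbeta).
move=> r0P; have [s [r [a [b [rP b0 -> gP /andP[_ nhi]]]]]] := word_state w r0P.
have [_ -> _] := gP (log_block psi).
have t1 : 1 < shift b r by apply: shift_gt1 => //; case/andP: rP.
have a0 : (0 < 1 + a)%N by [].
have /andP[_ hi] := growth a0 b0 rP.
have rP' : Gamma <= shift b r / scale (1 + a) (shift b r) <= 0.
  by apply: cone_step => //; case/andP: rP.
have u1 : scale (1 + a) (shift b r) < -1 by apply: scale_ltN1.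
have [n1 _] := andP (n_bounds rP'); have [_ n2] := andP (n_bounds r0P).
rewrite expRD expR_log_block ?psi_ge1//=.
set E := expR _ in nhi *; set q := psi _ _ in hi *.
have q1 : 1 <= q by rewrite /q psi_ge1.
have E0 : 0 <= E by exact: expR_ge0.
move: hi n1 rP' u1; set t := shift b r in t1 *.
set u := scale (1 + a) t => hi n1 rP' u1.
have uE : scale a t = u - alpha * t by rewrite /u /scale add1n -natr1; ring.
have su : `|s * u| <= 2 * (E * q).
  rewrite normrM; apply: (@le_trans _ _ (`|s| * (q * n r))).
    apply: ler_wpM2l => //; apply: le_trans hi.
    by rewrite ler_peMr.
  rewrite mulrCA [_ * (_ * q)]mulrA [_ * q]mulrC ler_wpM2l//.
    by rewrite (le_trans ler01).
  by rewrite (le_trans nhi)// mulrC ler_wpM2r.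
(* Since [Gamma > -1], the second coordinate dominates the first on the cone. *)
have G1 := Gam_gtN1.
have tu : t <= - u.
  case/andP: rP' => + _; rewrite ler_ndivlMr; last by lra.
  have : 0 <= (Gamma + 1) * - u by rewrite mulr_ge0//; lra.
  by lra.
have st : `|s * t| <= 2 * (E * q).
  apply: le_trans su; rewrite !normrM ler_wpM2l//.
  by rewrite ger0_norm ?ler0_norm; lra.
have Eq0 : 0 <= E * q by rewrite mulr_ge0//; lra.
have c0 : 0 <= - alpha * (E * q) by rewrite mulr_ge0//; lra.
split; first by apply: (le_trans st); lra.
rewrite uE mulrBr [s * (_ * _)]mulrCA (le_trans (ler_normB _ _))//.
rewrite [ `|alpha * _|]normrM.
have : `|alpha| * `|s * t| <= - alpha * (2 * (E * q)).
  by rewrite ltr0_norm ?ler_wpM2l//; lra.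
by lra.
Qed.

(** The start vectors for [r0 = 0] and [r0 = Gamma] differ by [(Gamma, 0)], so their images
    determine both columns of the matrix, at the cost of a division by [Gamma]. *)
Lemma wmx_norm_le : exists2 c : R, 0 < c & forall w, `|wmx w|
  <= c * expR (block_total (log_block psi) w + runA (log_block psi) 1 w).
Proof.
have [Ha Hb] := (Halpha, Hbeta).
have G0 := Gam_lt0; have GG : Gamma <= Gamma <= 0 by rewrite lexx ltW.
pose k := - (2 / Gamma).
have k0 : 0 < k by rewrite /k -mulrN -invrN mulr_gt0// invr_gt0 oppr_gt0.
exists ((k * (1 + beta) + 1) * (2 * (1 - alpha))) => [|w].
  by rewrite mulr_gt0//; [rewrite addr_gt0// mulr_gt0//|]; lra.
rewrite -mulrA; set D := _ * expR _.
have [z1 z2] := act_norm_le w zero_cone.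
have [y1 y2] := act_norm_le w GG.
rewrite -/D in z1 z2 y1 y2.
have [zE1 zE2] := wmx_act w (if last true w then beta + 0 else 0, 1).
have [yE1 yE2] := wmx_act w (if last true w then beta + Gamma else Gamma, 1).
have D0 : 0 <= D := le_trans (normr_ge0 _) z1.
have kD0 : 0 <= k * D by rewrite mulr_ge0// ltW.
have bkD0 : 0 <= beta * (k * D) by rewrite mulr_ge0//; lra.
have col (p q y z : R) : p * (if last true w then beta + 0 else 0) + q * 1 = z ->
    p * (if last true w then beta + Gamma else Gamma) + q * 1 = y ->
    `|z| <= D -> `|y| <= D ->
    `|p| <= (k * (1 + beta) + 1) * D /\ `|q| <= (k * (1 + beta) + 1) * D.
  move=> zE yE zD yD.
  have pG : p = (y - z) / Gamma.
    by rewrite -zE -yE; case: ifP => _; field; rewrite lt_eqF.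
  have pD : `|p| <= k * D.
    have -> : k * D = (2 * D) / - Gamma by rewrite /k; field; rewrite lt_eqF.
    rewrite pG normrM normfV [ `|Gamma|]ltr0_norm//.
    rewrite ler_pM2r ?invr_gt0 ?oppr_gt0// (le_trans (ler_normB _ _))//.
    by lra.
  split; first by apply: (le_trans pD); lra.
  have -> : q = z - p * (if last true w then beta + 0 else 0).
    by rewrite -zE; ring.
  rewrite (le_trans (ler_normB _ _))// normrM.
  have : `|p| * `|if last true w then beta + 0 else 0| <= k * D * beta.
    by rewrite ler_pM//; case: ifP => _; rewrite ?addr0 ?normr0 ?ger0_norm; lra.
  by lra.
have [? ?] := col _ _ _ _ zE1 yE1 z1 y1.
have [? ?] := col _ _ _ _ zE2 yE2 z2 y2.
exact: mx2_norm_le.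
Qed.

End Growth.
End Cone.

(** * Growth factors of a block in the three norms *)

Section BlockGrowth.
Context {R : realType} (alpha beta : R).
Hypotheses (Halpha : alpha < -2) (Hbeta : 2 < beta).
Local Notation Gamma := (Gam alpha beta).
Local Notation sh := (shift beta).
Local Notation sc := (scale alpha).

Lemma scale_anti a t t' : t <= t' -> sc a t' <= sc a t.
Proof.
have [Ha Hb] := (Halpha, Hbeta).
move=> tt; rewrite /scale lerD2l ler_wnM2l// mulr_ge0_le0//.
by lra.
Qed.

(** As [r] moves from [Gamma] to 0, both coordinates of the image of [(r, 1)] grow in absolute value
    while the norm of [(r, 1)] does not increase. Hence the growth factor lies between its values at
    the two ends. *)
Lemma block_bounds a b r : (0 < a)%N -> (0 < b)%N -> Gamma <= r <= 0 ->
  let t := sh b r in let t0 := sh b Gamma in let t1 := sh b 0 in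
  [/\ 1 < t0, t0 <= t, t <= t1 &
    [/\ sc a t0 < -1, sc a t <= sc a t0 & sc a t1 <= sc a t]].
Proof.
move=> a0 b0 /andP[Gr r0] t t0 t1.
have lt01 : 1 < t0 by exact: (shift_gt1 Halpha Hbeta b0 (lexx _)).
have le0 : t0 <= t by rewrite /t0 /t /shift lerD2r.
have le1 : t <= t1 by rewrite /t1 /t /shift lerD2r.
split=> //; split; first exact: (scale_ltN1 Halpha Hbeta a0).
  exact: scale_anti.
exact: scale_anti.
Qed.

Lemma block_homo a b a' b' : (0 < a <= a')%N -> (0 < b <= b')%N ->
  [/\ 1 < sh b 0, sh b 0 <= sh b' 0,
      sc a (sh b 0) < -1 & sc a' (sh b' 0) <= sc a (sh b 0)].
Proof.
have [Ha Hb] := (Halpha, Hbeta).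
move=> /andP[a0 aa] /andP[b0 bb].
have G0 : Gamma <= 0 by rewrite ltW// Gam_lt0.
have t1 : 1 < sh b 0 := shift_gt1 Halpha Hbeta b0 G0.
have tt : sh b 0 <= sh b' 0.
  by rewrite /shift !add0r ler_wpM2r ?ler_nat//; lra.
split=> //; first exact: (scale_ltN1 Halpha Hbeta a0).
apply: le_trans (scale_anti a tt); rewrite /scale lerD2l -!mulrA.
by rewrite ler_wnM2r ?ler_nat// mulr_le0_ge0//; lra.
Qed.

Lemma phi1E a b :
  phi1 alpha beta a b = (1 - Gamma)^-1 * (sh b Gamma - sc a (sh b Gamma)).
Proof. by rewrite /phi1 /shift /scale; congr (_ * _); ring. Qed.

Lemma phi2E a b : phi2 alpha beta a b =
  Num.sqrt ((1 + Gamma ^+ 2)^-1 * (sh b Gamma ^+ 2 + sc a (sh b Gamma) ^+ 2)).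
Proof. by rewrite /phi2 /shift /scale; congr (Num.sqrt (_ * _)); ring. Qed.

Lemma phiooE a b : phioo alpha beta a b = - sc a (sh b Gamma).
Proof. by rewrite /phioo /shift /scale; ring. Qed.

Lemma psi1E a b : psi1 alpha beta a b = sh b 0 - sc a (sh b 0).
Proof. by rewrite /psi1 /shift /scale; ring. Qed.

Lemma psi2E a b :
  psi2 alpha beta a b = Num.sqrt (sh b 0 ^+ 2 + sc a (sh b 0) ^+ 2).
Proof. by rewrite /psi2 /shift /scale; congr Num.sqrt; ring. Qed.

Lemma psiooE a b : psioo alpha beta a b = - sc a (sh b 0).
Proof. by rewrite /psioo /shift /scale; ring. Qed.

(* [n r] is the norm of [(r, 1)], so that [`|scale a t| * n (t / scale a t)] is
   the norm of [(t, scale a t)]. *)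
Definition growth_bounds (phi psi : nat -> nat -> R) (n : R -> R) : Prop :=
  [/\ forall a b, (0 < a)%N -> (0 < b)%N -> 1 <= phi a b,
      forall a b, (0 < a)%N -> (0 < b)%N -> 1 <= psi a b,
      forall a b a' b', (0 < a <= a')%N -> (0 < b <= b')%N ->
        psi a b <= psi a' b',
      forall r, Gamma <= r <= 0 -> 1 <= n r <= 2 &
      forall a b r, (0 < a)%N -> (0 < b)%N -> Gamma <= r <= 0 ->
      let t := sh b r in
      phi a b * n r <= `|sc a t| * n (t / sc a t) <= psi a b * n r].

Let zero_cone : Gamma <= 0 <= (0 : R).
Proof. by rewrite ltW ?(Gam_lt0 Halpha Hbeta) /=. Qed.

Lemma growth_bounds1 : growth_bounds (phi1 alpha beta) (psi1 alpha beta)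
  (fun r => 1 - r).
Proof.
have G0 := Gam_lt0 Halpha Hbeta; have G1 := Gam_gtN1 Halpha Hbeta.
split.
- move=> a b a0 b0; rewrite phi1E.
  have [? ? ? [? ? ?]] := block_bounds a0 b0 zero_cone.
  by rewrite mulrC ler_pdivlMr; lra.
- move=> a b a0 b0; rewrite psi1E.
  by have [? ? ? [? ? ?]] := block_bounds a0 b0 zero_cone; lra.
- move=> a b a' b' aP bP; rewrite !psi1E.
  by have [? ? ? ?] := block_homo aP bP; lra.
- by move=> r /andP[? ?]; apply/andP; split; lra.
- move=> a b r a0 b0 rP /=; set t := sh b r; rewrite phi1E psi1E.
  have [l0 l1 l2 [l3 l4 l5]] := block_bounds a0 b0 rP; case/andP: rP => Gr r0.
  rewrite -/t in l1 l2 l4 l5.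
  have st : sc a t < 0 by lra.
  rewrite ltr0_norm//.
  have -> : - sc a t * (1 - t / sc a t) = t - sc a t by field; rewrite lt_eqF.
  apply/andP; split.
    rewrite -mulrA mulrC ler_pdivrMr; last by lra.
    by rewrite ler_pM//; lra.
  by rewrite -[leLHS]mulr1 ler_pM//; lra.
Qed.

(** On the cone [|r| <= 1], so the maximum norm of [(r, 1)] is constantly 1. *)
Lemma growth_boundsoo : growth_bounds (phioo alpha beta) (psioo alpha beta)
  (fun=> 1).
Proof.
split.
- move=> a b a0 b0; rewrite phiooE.
  by have [? ? ? [? ? ?]] := block_bounds a0 b0 zero_cone; lra.
- move=> a b a0 b0; rewrite psiooE.
  by have [? ? ? [? ? ?]] := block_bounds a0 b0 zero_cone; lra.
- move=> a b a' b' aP bP; rewrite !psiooE.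
  by have [? ? ? ?] := block_homo aP bP; lra.
- by move=> r _; apply/andP; split; lra.
- move=> a b r a0 b0 rP /=; set t := sh b r; rewrite phiooE psiooE !mulr1.
  have [l0 l1 l2 [l3 l4 l5]] := block_bounds a0 b0 rP.
  rewrite -/t in l1 l2 l4 l5.
  by rewrite ler0_norm; [apply/andP; split|]; lra.
Qed.

Lemma growth_bounds2 : growth_bounds (phi2 alpha beta) (psi2 alpha beta)
  (fun r => Num.sqrt (1 + r ^+ 2)).
Proof.
have G0 := Gam_lt0 Halpha Hbeta; have G1 := Gam_gtN1 Halpha Hbeta.
have sq_le1 (r : R) : Gamma <= r <= 0 -> r ^+ 2 <= 1.
  move=> /andP[Gr r0]; rewrite -sqrrN -[leRHS](expr1n _ 2).
  by rewrite ler_pXn2r// ?nnegrE; lra.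
have sq_ge0 (r : R) : 0 <= r ^+ 2 := sqr_ge0 r.
have sq_le (x y : R) : 0 <= x -> x <= y -> x ^+ 2 <= y ^+ 2.
  by move=> x0 xy; rewrite ler_pXn2r// nnegrE; lra.
have sq_ge1 (x : R) : 1 <= x -> 1 <= x ^+ 2.
  by move=> x1; rewrite -[leLHS](expr1n _ 2) sq_le//; lra.
have GG : Gamma <= Gamma <= 0 by rewrite lexx ltW.
have G2 := sq_le1 _ GG.
have n0 (r : R) : 0 < 1 + r ^+ 2 by have := sq_ge0 r; lra.
split.
- move=> a b a0 b0; rewrite phi2E.
  have [l0 _ _ [l3 _ _]] := block_bounds a0 b0 zero_cone.
  move: (sh b Gamma) (sc a (sh b Gamma)) l0 l3 => t u l0 l3.
  have t2 : 1 <= t ^+ 2 by apply: sq_ge1; lra.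
  have u2 : 1 <= u ^+ 2 by rewrite -sqrrN; apply: sq_ge1; lra.
  rewrite -[leLHS]sqrtr1 ler_sqrt.
    by rewrite mulrC ler_pdivlMr//; lra.
  by rewrite mulr_ge0 ?invr_ge0 ?addr_ge0.
- move=> a b a0 b0; rewrite psi2E.
  have [? ? ? [? ? ?]] := block_bounds a0 b0 zero_cone.
  have t2 : 1 <= sh b 0 ^+ 2 by apply: sq_ge1; lra.
  have := sq_ge0 (sc a (sh b 0)) => u2.
  by rewrite -[leLHS]sqrtr1 ler_sqrt; lra.
- move=> a b a' b' aP bP; rewrite !psi2E ler_sqrt ?addr_ge0//.
  have [? ? ? ?] := block_homo aP bP; apply: lerD; first by apply: sq_le; lra.
  by rewrite -sqrrN -[leRHS]sqrrN; apply: sq_le; lra.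
- move=> r rP; have r2 := sq_le1 _ rP; have r20 := sq_ge0 r.
  have -> : (2 : R) = Num.sqrt (2 ^+ 2) by rewrite sqrtr_sqr ger0_norm.
  apply/andP; split; last by rewrite ler_sqrt; lra.
  by rewrite -[leLHS]sqrtr1 ler_sqrt; lra.
- move=> a b r a0 b0 rP /=; set t := sh b r; rewrite phi2E psi2E.
  have [l0 l1 l2 [l3 l4 l5]] := block_bounds a0 b0 rP.
  rewrite -/t in l1 l2 l4 l5.
  have st : sc a t < 0 by lra.
  have nn (x y : R) : 0 <= x ^+ 2 + y ^+ 2 := addr_ge0 (sq_ge0 x) (sq_ge0 y).
  have n0' (x : R) : 0 <= 1 + x ^+ 2 := ltW (n0 x).
  rewrite -sqrtr_sqr -!sqrtrM ?sq_ge0 ?nn ?mulr_ge0 ?invr_ge0 ?nn ?n0'//.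
  have -> : sc a t ^+ 2 * (1 + (t / sc a t) ^+ 2) = t ^+ 2 + sc a t ^+ 2.
    by field; rewrite lt_eqF.
  have t0t : sh b Gamma ^+ 2 <= t ^+ 2 by apply: sq_le; lra.
  have tt1 : t ^+ 2 <= sh b 0 ^+ 2 by apply: sq_le; lra.
  have s0s : sc a (sh b Gamma) ^+ 2 <= sc a t ^+ 2.
    by rewrite -sqrrN -[leRHS]sqrrN; apply: sq_le; lra.
  have ss1 : sc a t ^+ 2 <= sc a (sh b 0) ^+ 2.
    by rewrite -sqrrN -[leRHS]sqrrN; apply: sq_le; lra.
  have rG : r ^+ 2 <= Gamma ^+ 2.
    by rewrite -sqrrN -[leRHS]sqrrN; case/andP: rP => ? ?; apply: sq_le; lra.
  apply/andP; split; rewrite ler_sqrt ?nn//; last by rewrite mulr_ge0 ?nn.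
    by rewrite -mulrA mulrC ler_pdivrMr// ler_pM ?nn ?lerD.
  by rewrite -[leLHS]mulr1 ler_pM ?nn ?lerD// lerDl.
Qed.

End BlockGrowth.

(** * Convergence and expectation *)

(** Fekete's argument for [v n := u n + c], which is subadditive and nonnegative: the limit is the
    infimum of [v n / n] over [n > 0]. *)
Lemma almost_subadditive_cvg {R : realType} (u : nat -> R) (c : R) : 0 <= c ->
  (forall n, 0 <= u n + c) -> (forall n m, u (n + m)%N <= u n + u m + c) ->
  cvgn (fun n => n%:R^-1 * u n).
Proof.
move=> c0 uc0 usub; pose v n := u n + c.
have vsub q m r : v (q * m + r)%N <= q%:R * v m + v r.
  elim: q => [|q IH]; first by rewrite mul0n add0n mul0r add0r.
  rewrite mulSn -addnA (@le_trans _ _ (v m + v (q * m + r)%N))//.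
    by rewrite /v; have := usub m (q * m + r)%N; lra.
  by rewrite -natr1 mulrDl mul1r; lra.
pose A := [set n%:R^-1 * v n | n in [set n | (0 < n)%N]]%classic.
have A0 : (A !=set0)%classic by exists (1%:R^-1 * v 1%N); exists 1%N.
have v0 n : 0 <= v n := uc0 n.
have lbA : lbound A 0 by move=> _ [n _ <-]; rewrite mulr_ge0 ?uc0.
have infA : has_inf A by split=> //; exists 0.
apply/cvg_ex; exists (inf A); apply/cvgrPdist_le => e e0.
have e20 : 0 < e / 2 by rewrite divr_gt0.
have [_ [m m0 <-] vm] := inf_adherent e20 infA.
(* [B] bounds [v] at all remainders modulo [m], uniformly in [n]. *)
pose B := \sum_(r < m) v r.
have vB r : (r < m)%N -> v r <= B.
  by move=> rm; rewrite /B (bigD1 (Ordinal rm))//= lerDl sumr_ge0.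
have B0 : 0 <= B by apply: sumr_ge0.
near=> n.
have n0 : 0 < n%:R :> R by rewrite ltr0n; near: n; exists 1%N.
have nB : (B + c) <= n%:R * (e / 2).
  rewrite -ler_pdivrMr//; near: n; exact: nbhs_infty_ger.
rewrite ler_norml; apply/andP; split.
  rewrite lerBrDl lerBlDr.
  rewrite -(ler_pM2l n0) mulrA divff ?gt_eqF// mul1r mulrDr.
  apply: (@le_trans _ _ (v n)); first by rewrite /v lerDl.
  rewrite (divn_eq n m) (le_trans (vsub _ _ _))// -divn_eq.
  have qm : (n %/ m)%:R * v m <= n%:R * (m%:R^-1 * v m).
    rewrite mulrA ler_wpM2r ?uc0//.
    by rewrite ler_pdivlMr ?ltr0n// -natrM ler_nat leq_trunc_div.
  have := vB _ (ltn_pmod n m0).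
  have : n%:R * (m%:R^-1 * v m) <= n%:R * (inf A + e / 2).
    by rewrite ler_wpM2l// ltW.
  by lra.
have infv : inf A <= n%:R^-1 * v n.
  apply: ge_inf; first by exists 0.
  by exists n => //=; rewrite -(ltr0n R).
have nc : n%:R^-1 * c <= e by rewrite mulrC ler_pdivrMr// mulrC; lra.
by move: infv; rewrite /v mulrDr; lra.
Unshelve. all: by end_near.
Qed.

(** * Expectations as averages over words *)

Section WordExpectation.
Context {R : realType}.

Fixpoint words (N : nat) : seq (seq bool) :=
  if N is N'.+1 then
    [seq true :: w | w <- words N'] ++ [seq false :: w | w <- words N']
  else [:: [::]].

Lemma mem_words N w : (w \in words N) = (size w == N).
Proof.
elim: N w => [|N IH] [|c w] //=; rewrite mem_cat.
  by apply/negP => /orP[] /mapP[].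
have inj b : injective (cons b : seq bool -> _) by move=> x y [].
have notin b : (c :: w \in [seq b :: w' | w' <- words N])
    = (c == b) && (w \in words N).
  have [->|cb] := eqVneq c b; first by rewrite mem_map.
  by apply/negP => /mapP[x _ [cb' _]]; rewrite cb' eqxx in cb.
by rewrite !notin -andb_orl IH eqSS; case: c {notin}.
Qed.

Lemma words_uniq N : uniq (words N).
Proof.
elim: N => [//|N IH] /=; have inj b : injective (cons b : seq bool -> _).
  by move=> x y [].
rewrite cat_uniq !map_inj_uniq// IH !andbT /=.
by apply/hasPn => _ /mapP[x _ ->]; apply/negP => /mapP[].
Qed.

Lemma wavgE N (F : seq bool -> R) : wavg N F = 2 ^- N * \sum_(w <- words N) F w.
Proof.
elim: N F => [|N IH] F /=; first by rewrite big_seq1 expr0 invr1 mul1r.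
by rewrite !IH big_cat !big_map -mulrDr mulrC exprS invfM mulrA.
Qed.

(** By independence and fairness every word of length [N] is the prefix with probability [2 ^- N],
    and the integrand is a finite combination of the indicators of these events. *)
Lemma expectation_word d (T : measurableType d) (P : probability T R)
    (X : nat -> {RV P >-> bool}) (F : seq bool -> R) N : iid_fair_coins X ->
  ('E_P[fun x => F (mkseq (X^~ x) N)] = (wavg N F)%:E)%E.
Proof.
move=> [indep fair].
pose E w : set T := [set x | mkseq (X^~ x) N = w]%classic.
pose J : {fset nat} := [fset k in iota 0 N]%fset.
have mX k c : measurable (X k @^-1` [set c])%classic.
  by rewrite -[X in measurable X]setTI; exact: measurable_funP.
have Ecap w : size w = N ->
    E w = (\bigcap_(k in [set` J]) (X k @^-1` [set nth false w k]))%classic.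
  move=> sw; apply/seteqP; split=> x /= Ex.
    move=> k /=; rewrite !inE mem_iota add0n => kN.
    by rewrite -Ex nth_mkseq.
  apply: (@eq_from_nth _ false); first by rewrite size_mkseq.
  move=> k; rewrite size_mkseq => kN; rewrite nth_mkseq//.
  by apply: Ex; rewrite /= !inE mem_iota.
have mE w : measurable (E w).
  have [sw|sw] := eqVneq (size w) N.
    by rewrite (Ecap _ sw); apply: fin_bigcap_measurable => // k _; exact: mX.
  rewrite (_ : E w = set0)//; apply/seteqP; split=> // x /= xw.
  by rewrite -xw size_mkseq eqxx in sw.
have PE w : w \in words N -> P (E w) = (2 ^- N)%:E.
  rewrite mem_words => /eqP sw; rewrite (Ecap _ sw) indep//.
  under eq_bigr do rewrite fair.
  have szJ : size J = N by rewrite card_fseq undup_id ?iota_uniq// size_iota.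
  rewrite prodEFin big_const_seq count_predT szJ iter_mulr_1 exprVn.
  by [].
have -> : (fun x => F (mkseq (X^~ x) N))
    = (fun x => \sum_(w <- words N) F w * \1_(E w) x).
  apply/funext => x; set u := mkseq _ _.
  have uN : u \in words N by rewrite mem_words size_mkseq.
  rewrite (bigD1_seq u)//= ?words_uniq// big1 => [|w wu].
    by rewrite indicE mem_set ?mulr1 ?addr0.
  rewrite indicE memNset ?mulr0// => /= uw.
  by rewrite -uw eqxx in wu.
rewrite unlock.
under eq_integral => x _ do rewrite -sumEFin.
rewrite (integral_sum measurableT); last first.
  move=> w; under eq_fun do rewrite EFinM.
  by apply: integrableZl => //; exact: integrable_indic.
rewrite wavgE mulr_sumr -sumEFin; apply: eq_big_seq => w wN.
under eq_integral do rewrite EFinM.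
rewrite integralZl//; last exact: integrable_indic.
rewrite integral_indic// setIT mulrC EFinM.
by congr (_ * _)%E; exact: PE.
Qed.

End WordExpectation.

(** * The Lyapunov exponent *)

Section Series.
Context {R : realType}.

Lemma eq_eseries_ge N (f g : nat -> \bar R) :
  (forall i, (N <= i)%N -> f i = g i) ->
  (\sum_(N <= i <oo) f i = \sum_(N <= i <oo) g i)%E.
Proof.
move=> fg; congr (limn _); apply/funext => n.
by apply: eq_big_nat => i /andP[Ni _]; exact: fg.
Qed.

(** Every finite rectangle of indices lies in a square, so bounds on square sums pass to the
    iterated limit, first in [j] and then in [i]. *)
Lemma nneseries2_le (u : nat -> nat -> \bar R) (z : \bar R) :
  (forall i j, 0 <= u i j)%E ->
  (forall k, \sum_(1 <= i < 1 + k) \sum_(1 <= j < 1 + k) u i j <= z)%E ->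
  (\sum_(1 <= i <oo) \sum_(1 <= j <oo) u i j <= z)%E.
Proof.
move=> u0 uz; apply: lime_le.
  by apply: is_cvg_nneseries => i _ _; apply: nneseries_ge0 => j _ _.
near=> m; rewrite -nneseries_sum_nat//; apply: lime_le.
  by apply: is_cvg_nneseries => j _ _; apply: sume_ge0 => i _.
near=> k; rewrite exchange_big/=.
have mk : (m <= k)%N by near: k; exists m.
apply: le_trans (uz k).
apply: (@le_trans _ _ (\sum_(1 <= i < 1 + k) \sum_(1 <= j < k) u i j)%E).
  apply: lee_sum_nneg_natr; last by rewrite (leq_trans mk)// leq_addl.
  by move=> i _ _; apply: sume_ge0 => j _.
apply: lee_sum => i _; apply: lee_sum_nneg_natr; last exact: leq_addl.
by move=> j _ _.
Unshelve. all: by end_near.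
Qed.

Lemma cvg_slope_ge (u : nat -> R) (l x c : R) :
  (n%:R^-1 * u n @[n --> \oo] --> l)%classic ->
  (forall n, n%:R * x - c <= u n) -> x <= l.
Proof.
move=> /cvgrPdist_le ul xu; apply/ler_addgt0Pr => e e0.
have e20 : 0 < e / 2 by rewrite divr_gt0.
near \oo%classic => n.
have n0 : 0 < n%:R :> R by rewrite ltr0n; near: n; exists 1%N.
have cn : c <= n%:R * (e / 2).
  rewrite -ler_pdivrMr//; near: n; exact: nbhs_infty_ger.
have /ler_normlP[+ _] : `|l - n%:R^-1 * u n| <= e / 2.
  by near: n; exact: ul.
rewrite opprB lerBlDr -(ler_pM2l n0) mulrA divff ?gt_eqF// mul1r => un.
by rewrite -(ler_pM2l n0); have := xu n; lra.
Unshelve. all: by end_near.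
Qed.

Lemma cvg_slope_le (u : nat -> R) (l x c : R) :
  (n%:R^-1 * u n @[n --> \oo] --> l)%classic ->
  (forall n, u n <= n%:R * x + c) -> l <= x.
Proof.
move=> ul ux; rewrite -lerN2; apply: (@cvg_slope_ge (fun n => - u n) _ _ c).
  under eq_fun do rewrite mulrN.
  exact: cvgN.
by move=> n; have := ux n; rewrite mulrN; lra.
Qed.

End Series.

(** * Existence of the exponent and its two bounds *)

Section Lyapunov.
Context {R : realType} (alpha beta : R).
Hypotheses (Halpha : alpha < -2) (Hbeta : 2 < beta).
Local Notation wmx := (wmx alpha beta).
Local Notation avg_ln := (fun N => wavg N (fun w => ln `|wmx w|)).

Lemma log_block_ge0 (f : nat -> nat -> R) a b :
  (forall a b, (0 < a)%N -> (0 < b)%N -> 1 <= f a b) -> 0 <= log_block f a b.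
Proof.
move=> f1; rewrite /log_block; case: ifP => // /andP[a0 b0].
by rewrite ln_ge0// f1.
Qed.

Lemma log_block_le (f : nat -> nat -> R) a b a' b' :
  (forall a b, (0 < a)%N -> (0 < b)%N -> 1 <= f a b) ->
  (forall a b a' b', (0 < a <= a')%N -> (0 < b <= b')%N -> f a b <= f a' b') ->
  (a <= a')%N -> (b <= b')%N -> log_block f a b <= log_block f a' b'.
Proof.
move=> f1 fle aa bb; rewrite {1}/log_block.
case: ifP => [/andP[a0 b0]|_]; last exact: log_block_ge0.
have a0' := leq_trans a0 aa; have b0' := leq_trans b0 bb.
have f_gt0 c e : (0 < c)%N -> (0 < e)%N -> 0 < f c e.
  by move=> c0 e0; rewrite (lt_le_trans ltr01)// f1.
by rewrite /log_block a0' b0' /= ler_ln ?posrE ?f_gt0// fle ?a0 ?b0.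
Qed.

Lemma log_sumE (f : nat -> nat -> R) : log_sum f =
  (\sum_(1 <= i <oo) \sum_(1 <= j <oo) (2 ^- (i + j) * log_block f i j)%:E)%E.
Proof.
apply: eq_eseries_ge => i i1; apply: eq_eseries_ge => j j1.
by rewrite /log_block i1 j1.
Qed.

Lemma mulmx2_norm_le (M M' : 'M[R]_2) : `|M *m M'| <= 2 * `|M| * `|M'|.
Proof.
have E i j : `|(M *m M') i j| <= 2 * `|M| * `|M'|.
  rewrite mxE big_ord_recl big_ord1 (le_trans (ler_normD _ _))// !normrM.
  rewrite mulr_natl mulr2n mulrDl.
  by apply: lerD; apply: ler_pM => //; exact: ler_mx_entry.
exact: mx2_norm_le.
Qed.

Lemma shear_productE (i : nat -> bool) N :
  shear_product alpha beta i N = wmx (mkseq i N).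
Proof.
by rewrite /shear_product /wmx /mkseq big_map -[in RHS](subn0 N) big_mkord.
Qed.

(** The additive loss in [wmx_norm_ge]; being at least [ln 2], it also absorbs the factor 2 in
    [mulmx2_norm_le]. *)
Let c := ln (2 * (beta + 1)).

Let block_total_le_ln (phi psi : nat -> nat -> R) n w :
  growth_bounds alpha beta phi psi n ->
  0 < `|wmx w| /\ block_total (log_block phi) w <= ln `|wmx w| + c.
Proof.
have [Ha Hb] := (Halpha, Hbeta).
move=> [phi1 psi1 _ nb gr].
have := wmx_norm_ge Halpha Hbeta phi1 psi1 nb gr w.
have b0 : 0 < 2 * (beta + 1) by lra.
move=> le; have M0 : 0 < `|wmx w|.
  by rewrite -(pmulr_rgt0 _ b0) (lt_le_trans _ le)// expR_gt0.
split=> //; rewrite addrC /c -lnM ?posrE//.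
by rewrite -[leLHS]expRK ler_ln ?posrE ?expR_gt0// (mulr_gt0 b0 M0).
Qed.

Let wmx_gt0 w : 0 < `|wmx w|.
Proof. by have [] := block_total_le_ln w (growth_boundsoo Halpha Hbeta). Qed.

(** Submultiplicativity up to the factor 2 gives subadditivity up to [c], and the nonnegative block
    sum bounds the averages below by [- c]. *)
Lemma avg_ln_cvg : cvgn (fun N => N%:R^-1 * avg_ln N).
Proof.
have [Ha Hb] := (Halpha, Hbeta).
have c2 : ln 2 <= c by rewrite ler_ln ?posrE//; lra.
have c0 : 0 <= c by rewrite (le_trans _ c2)// ln_ge0// ler1n.
apply: (@almost_subadditive_cvg R avg_ln c c0) => [N|N M].
  rewrite -[in leRHS](wavg_cst N c) -wavgD; apply: wavg_ge0 => w.
  have gb := growth_boundsoo Halpha Hbeta; have [phi1 _ _ _ _] := gb.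
  have [_] := block_total_le_ln w gb; apply: le_trans.
  by apply: block_total_ge0 => a b; exact: log_block_ge0.
have -> : wavg N (fun w => ln `|wmx w|) + wavg M (fun w => ln `|wmx w|) + c
    = wavg N (fun w => wavg M (fun w' => ln `|wmx w| + (ln `|wmx w'| + c))).
  under [in RHS]eq_fun => w do rewrite wavgD wavg_cst wavgD wavg_cst.
  by rewrite wavgD wavg_cst addrA.
rewrite wavg_cat; apply: le_wavg => w; apply: le_wavg => w'.
have M0 := wmx_gt0 w; have M0' := wmx_gt0 w'.
apply: (@le_trans _ _ (ln `|wmx w| + (ln `|wmx w'| + ln 2))); last first.
  by rewrite !lerD2l.
rewrite -!lnM ?posrE ?mulr_gt0// ler_ln ?posrE ?mulr_gt0 ?wmx_gt0//.
rewrite mulrA [leRHS]mulrC mulrA.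
by rewrite /wmx big_cat; exact: mulmx2_norm_le.
Qed.

Local Notation l := (limn (fun N => N%:R^-1 * avg_ln N)).

Section Bounds.
Variables (phi psi : nat -> nat -> R) (n : R -> R).
Hypothesis gb : growth_bounds alpha beta phi psi n.

Lemma log_sum_le_lim : (log_sum phi <= (4 * l)%:E)%E.
Proof.
have [phi1 _ _ _ _] := gb.
have g0 a b : 0 <= log_block phi a b by exact: log_block_ge0.
rewrite log_sumE; apply: nneseries2_le => [i j|k].
  by rewrite lee_fin mulr_ge0// invr_ge0 exprn_ge0.
under eq_bigr do rewrite sumEFin.
rewrite sumEFin lee_fin; set S := \sum_(1 <= i < _) _.
have -> : S = 4 * (S / 4) by field.
rewrite ler_pM2l//.
(* For a fixed truncation [k] the loss does not depend on the word length, so it disappears in the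
   slope. *)
apply: (@cvg_slope_ge _ avg_ln _ _ ((k + k).+1%:R * (S / 4) + c)).
  exact: avg_ln_cvg.
move=> m; rewrite opprD addrA -mulrBl mulrA lerBlDr.
apply: le_trans (wavg_block_total_ge g0 k m) _.
rewrite -[in leRHS](wavg_cst m c) -wavgD; apply: le_wavg => w.
by have [] := block_total_le_ln w gb.
Qed.

Lemma lim_le_log_sum : ((4 * l)%:E <= log_sum psi)%E.
Proof.
have [phi1 psi1 psi_le nb gr] := gb.
have g0 a b : 0 <= log_block psi a b by exact: log_block_ge0.
have gS1 a b : log_block psi a b <= log_block psi a.+1 b by exact: log_block_le.
have gS2 a b : log_block psi a b <= log_block psi a b.+1 by exact: log_block_le.
have [k k0 kP] := wmx_norm_le Halpha Hbeta phi1 psi1 nb gr.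
rewrite log_sumE; set L := (\sum_(1 <= i <oo) _)%E.
have L0 : (0 <= L)%E.
  apply: nneseries_ge0 => i _ _; apply: nneseries_ge0 => j _ _.
  by rewrite lee_fin mulr_ge0// invr_ge0 exprn_ge0.
(* An infinite series bounds anything; otherwise its value [r] is a real number. *)
case LE : L L0 => [r| |] L0 //; last by rewrite leey.
rewrite lee_fin mulrC -ler_pdivlMr//.
(* Here [ln k] comes from the comparison of norms, and [r] bounds the mean contribution of the
   incomplete leading block. *)
apply: (@cvg_slope_le _ avg_ln _ _ (ln k + r)); first exact: avg_ln_cvg.
have LEr : (L <= r%:E)%E by rewrite LE.
move=> m; have [runr totr] := wavg_block_total_le g0 gS1 gS2 m LEr.
apply: (@le_trans _ _ (wavg m (fun w => (block_total (log_block psi) w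
    + runA (log_block psi) 1 w) + ln k))).
  apply: le_wavg => w.
  rewrite -[X in X + ln k]expRK addrC -lnM ?posrE ?expR_gt0//.
  by rewrite ler_ln ?posrE ?mulr_gt0 ?expR_gt0 ?wmx_gt0.
by rewrite !wavgD wavg_cst mulrA; lra.
Qed.

End Bounds.

Lemma lyapunov_exponentE d (T : measurableType d) (P : probability T R)
    (X : nat -> {RV P >-> bool}) : iid_fair_coins X ->
  lyapunov_exponent X alpha beta = l%:E.
Proof.
move=> HX; rewrite /lyapunov_exponent.
have -> : (fun N => (N%:R^-1)%:E * 'E_P[fun x =>
      ln `|shear_product alpha beta (fun k => X k x) N|])%E
    = (fun N => (N%:R^-1 * avg_ln N)%:E).
  apply/funext => N; under eq_fun do rewrite shear_productE.
  by rewrite (expectation_word (fun w => ln `|wmx w|)) ?EFinM.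
apply: cvg_lim => //; apply: cvg_EFin; first by near=> N.
exact: avg_ln_cvg.
Unshelve. all: by end_near.
Qed.

End Lyapunov.

Theorem theorem4 (R : realType) (d : measure_display) (T : measurableType d)
    (P : probability T R) (X : nat -> {RV P >-> bool}) (alpha beta : R)
    (HX : iid_fair_coins X) (Halpha : alpha < -2) (Hbeta : 2 < beta) :
  (maxe (maxe (log_sum (phi1 alpha beta)) (log_sum (phi2 alpha beta)))
        (log_sum (phioo alpha beta))
     <= 4%:E * lyapunov_exponent X alpha beta)%E
  /\
  (4%:E * lyapunov_exponent X alpha beta
     <= mine (mine (log_sum (psi1 alpha beta)) (log_sum (psi2 alpha beta)))
             (log_sum (psioo alpha beta)))%E.
Proof.
rewrite (lyapunov_exponentE Halpha Hbeta HX) -EFinM !ge_max !le_min.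
have gb1 := growth_bounds1 Halpha Hbeta.
have gb2 := growth_bounds2 Halpha Hbeta.
have gboo := growth_boundsoo Halpha Hbeta.
split; rewrite -andbA; apply/and3P; split.
- exact: log_sum_le_lim gb1.
- exact: log_sum_le_lim gb2.
- exact: log_sum_le_lim gboo.
- exact: lim_le_log_sum gb1.
- exact: lim_le_log_sum gb2.
- exact: lim_le_log_sum gboo.
Qed.
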